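(* Let $(R,\mathfrak m)$ be a Cohen-Macaulay noetherian local ring of dimension $d$ and let $B$ be torsionless as an $R$-module. Then $\operatorname{Hom}_R\bigl(H^d_{\mathfrak m}(B),H^d_{\mathfrak m}(R)\bigr)\neq 0$.
   Context: $H^d_{\mathfrak m}(-)$ is the $d$-th local cohomology functor with respect to $\mathfrak m$. With $(-)^*=\operatorname{Hom}_R(-,R)$, an $R$-module $B$ (not necessarily finitely generated) is torsionless if the natural map $B\to B^{**}$ is injective.
   Formalization: The module B is assumed nonzero: the zero module is torsionless, but then the local cohomology of B and the Hom module are both 0, so the claim as printed fails for B = 0. *)

(* Defs.v *)
From HB Require Import structures.
From mathcomp Require Import all_boot all_algebra.
From mathcomp Require Import ring_quotient generic_quotient.
From mathcomp Require Import boolp.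

Set Implicit Arguments.
Unset Strict Implicit.
Unset Printing Implicit Defensive.

Import GRing.Theory.

Local Open Scope ring_scope.
Local Open Scope quotient_scope.

(* [idealr_closed] and [prime_idealr] are MathComp's proper ideals and (proper)
   prime ideals; possibly improper ideals of [R] are the submodules of [R^o]. *)

Definition is_ideal (R : comNzRingType) (I : {pred R}) : Prop :=
  submod_closed (I : {pred R^o}).

Definition ideal_gen (R : comNzRingType) (xs : seq R) : {pred R} :=
  fun a => `[< exists c : 'I_(size xs) -> R,
                 a = \sum_(i < size xs) c i * xs`_i >].

Definition ideal_mul (R : comNzRingType) (I J : {pred R}) : {pred R} :=
  fun a => `[< exists2 s : seq (R * R),
                 (forall p, p \in s -> p.1 \in I /\ p.2 \in J)
                 & a = \sum_(p <- s) p.1 * p.2 >].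

Fixpoint ideal_exp (R : comNzRingType) (I : {pred R}) (n : nat) : {pred R} :=
  if n is k.+1 then ideal_mul I (ideal_exp I k) else predT.

Definition noetherian (R : comNzRingType) : Prop :=
  forall I : {pred R}, is_ideal I -> exists xs : seq R, I =i ideal_gen xs.

Definition maximal_ideal (R : comNzRingType) (I : {pred R}) : Prop :=
  idealr_closed I /\
  forall J : {pred R}, idealr_closed J -> {subset I <= J} -> J =i I.

Definition is_local_ring (R : comNzRingType) (m : {pred R}) : Prop :=
  maximal_ideal m /\ forall I : {pred R}, maximal_ideal I -> I =i m.

(* [p 0, ..., p n] is a strictly increasing chain of primes; the values of
   [p] beyond [n] are irrelevant. *)
Definition prime_chain (R : comNzRingType) (n : nat)
    (p : nat -> prime_idealr R) : Prop :=
  forall i, (i < n)%N ->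
    {subset p i <= p i.+1} /\ ~ {subset p i.+1 <= p i}.

Definition krull_dim_eq (R : comNzRingType) (d : nat) : Prop :=
  (exists p : nat -> prime_idealr R, prime_chain d p) /\
  (forall n (p : nat -> prime_idealr R), prime_chain n p -> (n <= d)%N).

(* Each [xs_i] is a nonzerodivisor on [R / (xs_0, ..., xs_(i-1))], and
   [R / (xs)] is nonzero. *)
Definition regular_sequence (R : comNzRingType) (xs : seq R) : Prop :=
  (forall i, (i < size xs)%N -> forall a,
     xs`_i * a \in ideal_gen (take i xs) -> a \in ideal_gen (take i xs)) /\
  1 \notin ideal_gen xs.

Definition depth_eq (R : comNzRingType) (m : {pred R}) (e : nat) : Prop :=
  (exists xs : seq R,
     [/\ {subset xs <= m}, regular_sequence xs & size xs = e]) /\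
  (forall xs : seq R,
     {subset xs <= m} -> regular_sequence xs -> (size xs <= e)%N).

Definition cohen_macaulay_local (R : comNzRingType) (m : {pred R}) (d : nat)
    : Prop :=
  [/\ noetherian R, is_local_ring m, krull_dim_eq R d & depth_eq m d].

Definition linhom (R : comNzRingType) (U V : lmodType R) := {linear U -> V}.

Section HomModule.
Context (R : comNzRingType) (U V : lmodType R).
Implicit Types (f g h : linhom U V) (a b : R).

Lemma homP f g : f =1 g -> f = g.
Proof.
case: f g => [f [[fD] [fZ]]] [g [[gD] [gZ]]] /= /funext efg; subst g.
by rewrite (Prop_irrelevance fD gD) (Prop_irrelevance fZ gZ).
Qed.

HB.instance Definition _ := gen_eqMixin (linhom U V).
HB.instance Definition _ := gen_choiceMixin (linhom U V).

Definition hom_zero : linhom U V := \0.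
Definition hom_opp f : linhom U V := \- f.
Definition hom_add f g : linhom U V := f \+ g.
Definition hom_scale a f : linhom U V := a \*: f.

Fact hom_addA : associative hom_add.
Proof. by move=> f g h; apply: homP => x /=; rewrite addrA. Qed.
Fact hom_addC : commutative hom_add.
Proof. by move=> f g; apply: homP => x /=; rewrite addrC. Qed.
Fact hom_add0 : left_id hom_zero hom_add.
Proof. by move=> f; apply: homP => x /=; rewrite add0r. Qed.
Fact hom_addN : left_inverse hom_zero hom_opp hom_add.
Proof. by move=> f; apply: homP => x /=; rewrite addNr. Qed.

HB.instance Definition _ :=
  GRing.isZmodule.Build (linhom U V) hom_addA hom_addC hom_add0 hom_addN.

Fact hom_scaleA a b f : hom_scale a (hom_scale b f) = hom_scale (a * b) f.
Proof. by apply: homP => x /=; rewrite scalerA. Qed.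
Fact hom_scale1 : left_id 1 hom_scale.
Proof. by move=> f; apply: homP => x /=; rewrite scale1r. Qed.
Fact hom_scaleDr : right_distributive hom_scale +%R.
Proof. by move=> a f g; apply: homP => x /=; rewrite scalerDr. Qed.
Fact hom_scaleDl f : {morph hom_scale^~ f : a b / a + b}.
Proof. by move=> a b; apply: homP => x /=; rewrite scalerDl. Qed.

HB.instance Definition _ := GRing.Zmodule_isLmodule.Build R (linhom U V)
  hom_scaleA hom_scale1 hom_scaleDr hom_scaleDl.

End HomModule.

Definition dual_module (R : comNzRingType) (B : lmodType R) : lmodType R :=
  linhom B R^o.

Section Bidual.
Context (R : comNzRingType) (B : lmodType R).

Definition bidual_fun (b : B) : dual_module B -> R^o := fun f => (f : linhom B R^o) b.

Fact bidual_fun_linear b : linear (bidual_fun b).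
Proof. by []. Qed.

HB.instance Definition _ b :=
  GRing.isLinear.Build R (dual_module B) R^o *:%R (bidual_fun b) (bidual_fun_linear b).

Definition bidual_map (b : B) : dual_module (dual_module B) :=
  (bidual_fun b : {linear dual_module B -> R^o}).

End Bidual.

Definition torsionless (R : comNzRingType) (B : lmodType R) : Prop :=
  injective (@bidual_map R B).

Record submodule (R : comNzRingType) (V : lmodType R) (S : submodClosed V) :=
  Submodule { submodule_val : V; submodule_valP : submodule_val \in S }.

Section SubmoduleStructure.
Context (R : comNzRingType) (V : lmodType R) (S : submodClosed V).

HB.instance Definition _ := [isSub for @submodule_val R V S].
HB.instance Definition _ := [Choice of submodule S by <:].
HB.instance Definition _ := [SubChoice_isSubLmodule of submodule S by <:].

End SubmoduleStructure.

(* MathComp's [submodClosed] does not inherit from [zmodClosed]: a copy of the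
   predicate carries the latter structure, on which [Quotient.quot] is built. *)
Definition submod_zpred (R : comNzRingType) (V : lmodType R)
  (S : submodClosed V) : {pred V} := fun x => x \in S.

HB.instance Definition _ (R : comNzRingType) (V : lmodType R)
    (S : submodClosed V) :=
  GRing.isZmodClosed.Build V (submod_zpred S)
    (GRing.submod_closedB (submodClosedP S)).

Definition quotient_module (R : comNzRingType) (V : lmodType R)
  (S : submodClosed V) : Type := Quotient.quot (submod_zpred S).

Section QuotientModule.
Context (R : comNzRingType) (V : lmodType R) (S : submodClosed V).

HB.instance Definition _ := GRing.Zmodule.on (quotient_module S).
HB.instance Definition _ := Quotient.on (quotient_module S).

Local Notation Q := (quotient_module S).
Implicit Types (a b : R) (q : Q).

Definition quot_scale a q : Q := \pi_Q (a *: repr q).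

Lemma quot_piE (x y : V) : (\pi_Q x = \pi_Q y) <-> (x - y \in S).
Proof.
split=> [/eqP|xy]; last apply/eqP;
  by rewrite -[Q]/(Quotient.quot (submod_zpred S)) -Quotient.idealrBE.
Qed.

Lemma quot_scaleE a (x : V) : quot_scale a (\pi_Q x) = \pi_Q (a *: x).
Proof.
apply/quot_piE; rewrite -scalerBr; apply: rpredZ.
by apply/quot_piE; rewrite reprK.
Qed.

Lemma quot_piD : {morph \pi_Q : x y / x + y}.
Proof. exact: (@Quotient.pi_add V (submod_zpred S)). Qed.

Fact quot_scaleA a b q : quot_scale a (quot_scale b q) = quot_scale (a * b) q.
Proof. by rewrite -[q]reprK !quot_scaleE scalerA reprK. Qed.
Fact quot_scale1 : left_id 1 quot_scale.
Proof. by move=> q; rewrite -[q]reprK quot_scaleE scale1r. Qed.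
Fact quot_scaleDr : right_distributive quot_scale +%R.
Proof.
move=> a p q; rewrite -[p]reprK -[q]reprK -quot_piD !quot_scaleE scalerDr.
exact: quot_piD.
Qed.
Fact quot_scaleDl q : {morph quot_scale^~ q : a b / a + b}.
Proof.
move=> a b; rewrite -[q]reprK !quot_scaleE scalerDl; exact: quot_piD.
Qed.

HB.instance Definition _ := GRing.Zmodule_isLmodule.Build R Q
  quot_scaleA quot_scale1 quot_scaleDr quot_scaleDl.

End QuotientModule.

Record cochain_complex (R : comNzRingType) := CochainComplex {
  cochain :> nat -> lmodType R;
  differential : forall n, {linear cochain n -> cochain n.+1};
  differential_sq : forall n x, differential n.+1 (differential n x) = 0
}.

Section Cohomology.
Context (R : comNzRingType) (C : cochain_complex R) (n : nat).

Definition cocycles : {pred C n} := fun x => differential C n x == 0.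

Fact cocycles_submod : submod_closed cocycles.
Proof.
split=> [|a x y]; rewrite !unfold_in ?linear0 // => /eqP x0 /eqP y0.
by rewrite linearP x0 y0 scaler0 addr0.
Qed.

HB.instance Definition _ :=
  GRing.isSubmodClosed.Build R (C n) cocycles cocycles_submod.

End Cohomology.

Section CohomologyModule.
Context (R : comNzRingType) (C : cochain_complex R).

Definition is_coboundary (n : nat) : C n -> Prop :=
  match n with
  | 0 => fun x => x = 0
  | k.+1 => fun x => exists y : C k, x = differential C k y
  end.

Fact is_coboundary0 n : is_coboundary (0 : C n).
Proof. by case: n => //= n; exists 0; rewrite linear0. Qed.

Fact is_coboundaryP n a (x y : C n) :
  is_coboundary x -> is_coboundary y -> is_coboundary (a *: x + y).
Proof.
case: n x y => [|n] /= x y; first by move=> -> ->; rewrite scaler0 addr0.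
by move=> [u ->] [v ->]; exists (a *: u + v); rewrite linearP.
Qed.

Definition coboundaries (n : nat) : {pred submodule (@cocycles R C n)} :=
  fun z => `[< is_coboundary (\val z) >].

Fact coboundaries_submod n : submod_closed (@coboundaries n).
Proof.
split=> [|a x y]; first by apply/asboolP; exact: is_coboundary0.
by move=> /asboolP hx /asboolP hy; apply/asboolP; exact: is_coboundaryP.
Qed.

HB.instance Definition _ n := GRing.isSubmodClosed.Build R
  (submodule (@cocycles R C n)) (@coboundaries n) (@coboundaries_submod n).

Definition cohomology (n : nat) : lmodType R :=
  quotient_module (@coboundaries n).

End CohomologyModule.

Definition injective_module (R : comNzRingType) (E : lmodType R) : Prop :=
  forall (A C : lmodType R) (i : {linear A -> C}) (f : {linear A -> E}),
    injective i -> exists g : {linear C -> E}, forall a, g (i a) = f a.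

Record injective_resolution (R : comNzRingType) (M : lmodType R) :=
  InjectiveResolution {
    resolution :> cochain_complex R;
    augmentation : {linear M -> resolution 0};
    resolution_injective : forall n, injective_module (resolution n);
    augmentation_inj : injective augmentation;
    resolution_exact0 : forall x : resolution 0,
      differential resolution 0 x = 0 <-> exists b, x = augmentation b;
    resolution_exact : forall n (x : resolution n.+1),
      differential resolution n.+1 x = 0 <->
      exists y, x = differential resolution n y
  }.

Section Torsion.
Context (R : comNzRingType) (I : {pred R}).

Fact ideal_expS n k : {subset ideal_exp I (k + n) <= ideal_exp I n}.
Proof.
have step j : {subset ideal_exp I j.+1 <= ideal_exp I j}.
  elim: j => [//|j IHj] a /asboolP[s Is ->]; apply/asboolP; exists s => // p ps.
  by have [Ip /IHj] := Is p ps.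
by elim: k => [//|k IHk] a /step; exact: IHk.
Qed.

Section TorsionModule.
Context (E : lmodType R).

Definition torsion : {pred E} :=
  fun x => `[< exists n, forall a, a \in ideal_exp I n -> a *: x = 0 >].

Fact torsion_submod : submod_closed torsion.
Proof.
split=> [|b x y].
  by apply/asboolP; exists 0%N => a _; rewrite scaler0.
move=> /asboolP[n xn] /asboolP[k yk]; apply/asboolP; exists (n + k)%N => a ank.
rewrite scalerDr scalerA mulrC -scalerA xn ?yk ?scaler0 ?addr0 //.
  exact: ideal_expS ank.
by rewrite addnC in ank; exact: ideal_expS ank.
Qed.

HB.instance Definition _ := GRing.isSubmodClosed.Build R E torsion torsion_submod.

Definition torsion_module : lmodType R := submodule torsion.

End TorsionModule.

Section TorsionMap.
Context (E F : lmodType R) (f : {linear E -> F}).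

Fact torsion_map_subproof (x : torsion_module E) : f (\val x) \in @torsion F.
Proof.
case: x => x /= /asboolP[n xn]; apply/asboolP; exists n => a /xn ax.
by rewrite -linearZ ax linear0.
Qed.

Definition torsion_map (x : torsion_module E) : torsion_module F :=
  Submodule (torsion_map_subproof x).

Fact torsion_map_linear : linear torsion_map.
Proof. by move=> a x y; apply: val_inj; rewrite /= linearP. Qed.

HB.instance Definition _ := GRing.isLinear.Build R (torsion_module E)
  (torsion_module F) *:%R torsion_map torsion_map_linear.

End TorsionMap.

Section TorsionComplex.
Context (C : cochain_complex R).

Fact torsion_complex_sq n (x : torsion_module (C n)) :
  torsion_map (differential C n.+1) (torsion_map (differential C n) x) = 0.
Proof. by apply: val_inj; rewrite /= differential_sq. Qed.

Definition torsion_complex : cochain_complex R :=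
  @CochainComplex R (fun n => torsion_module (C n))
    (fun n => torsion_map (differential C n)) torsion_complex_sq.

End TorsionComplex.

End Torsion.

(* The value at [M] of the [n]-th right derived functor of the [I]-power-torsion
   functor, computed from a given injective resolution [E] of [M]. *)
Definition local_cohomology (R : comNzRingType) (I : {pred R})
    (M : lmodType R) (E : injective_resolution M) (n : nat) : lmodType R :=
  cohomology (torsion_complex I E) n.

(* Main.v *)
(** A non-zero [b] in the torsionless module [B] has [f b != 0] for some
    [f : B -> R], and the map that [f] induces on [H^d_m] is non-zero.

    A maximal regular sequence can be replaced by powers of its members so that
    the resulting sequence [z] satisfies [f b \notin (z)].  In an injective
    resolution of [B], the [d] successive connecting homomorphisms of
    multiplication by [z_1], ..., [z_d] carry [b] to a cocycle [c] killed by
    [(z)]; as [R] is Cohen-Macaulay, [(z)] contains a power of [m], so [c]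
    defines a class in [H^d_m(B)].  Its image in [H^d_m(R)] comes in the same
    way from [f b].  If it were the coboundary of an [m]-torsion element, the latter
    would be killed by all [z_i^N] for some [N]; but with respect to [z^N], the
    same cocycle comes from [(z_1 ... z_d)^(N-1) * f b], and this would force
    [(z_1 ... z_d)^(N-1) * f b \in (z_1^N, ..., z_d^N)], that is,
    [f b \in (z)]. *)

Require Import Defs.
From HB Require Import structures.
From mathcomp Require Import all_boot all_algebra.
From mathcomp Require Import ring_quotient generic_quotient boolp ring.

Import GRing.Theory.

Local Open Scope ring_scope.

Set Implicit Arguments.
Unset Strict Implicit.

(** * Regular sequences modulo an ideal *)

Section Ideals.
Context (R : comNzRingType).
Implicit Types (J K : R -> Prop) (a b c x y z : R) (xs zs : seq R).

Definition ideal J := J 0 /\ forall a x y, J x -> J y -> J (a * x + y).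

Definition zero_ideal a := a = 0.

(** The ideal [J + (x)]; folding it over a sequence gives [J + (xs)], with a base ideal that
    inductions on [xs] can change. *)
Definition adjoin J x a := exists b, J (a - b * x).

Definition nonzerodivisor_mod J x := forall a, J (x * a) -> J a.

(** A weakly regular sequence on [R / J]: the quotient by all of [xs] may vanish. *)
Fixpoint regular_mod J xs := if xs is x :: ys
  then nonzerodivisor_mod J x /\ regular_mod (adjoin J x) ys else True.

Lemma idealM J a x : ideal J -> J x -> J (a * x).
Proof. by move=> [J0 JP] Jx; rewrite -[a * x]addr0; apply: JP. Qed.

Lemma idealD J x y : ideal J -> J x -> J y -> J (x + y).
Proof. by move=> [_ JP] Jx Jy; rewrite -[x]mul1r; apply: JP. Qed.

Lemma idealB J x y : ideal J -> J x -> J y -> J (x - y).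
Proof.
by move=> idJ Jx Jy; apply: idealD => //; rewrite -mulN1r; apply: idealM.
Qed.

Lemma zero_ideal_ideal : ideal zero_ideal.
Proof. by split=> // a x y -> ->; rewrite /zero_ideal mulr0 addr0. Qed.

Lemma adjoin_ideal J x : ideal J -> ideal (adjoin J x).
Proof.
move=> [J0 JP]; split=> [|a u v [b Ju] [c Jv]].
  by exists 0; rewrite mul0r subr0.
exists (a * b + c).
by have := JP a _ _ Ju Jv; congr (J _); ring.
Qed.

Lemma sub_adjoin J x a : J a -> adjoin J x a.
Proof. by exists 0; rewrite mul0r subr0. Qed.

Lemma mem_adjoin J x : ideal J -> adjoin J x x.
Proof. by move=> [J0 _]; exists 1; rewrite mul1r subrr. Qed.

Lemma adjoinC J x y : adjoin (adjoin J x) y = adjoin (adjoin J y) x.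
Proof.
by apply/funext => a; apply/propext; split=> -[b [c Jabc]]; exists c, b;
  move: Jabc; congr (J _); ring.
Qed.

Lemma foldl_adjoinC J x xs :
  foldl adjoin (adjoin J x) xs = adjoin (foldl adjoin J xs) x.
Proof. by elim: xs J => //= y xs IH J; rewrite adjoinC IH. Qed.

Lemma foldl_adjoin_ideal J xs : ideal J -> ideal (foldl adjoin J xs).
Proof. by elim: xs J => //= x xs IH J idJ; apply/IH/adjoin_ideal. Qed.

Lemma sub_foldl_adjoin J xs a : J a -> foldl adjoin J xs a.
Proof. by elim: xs J => //= x xs IH J Ja; apply/IH/sub_adjoin. Qed.

Lemma mem_foldl_adjoin J xs x : ideal J -> x \in xs -> foldl adjoin J xs x.
Proof.
elim: xs J => //= y xs IH J idJ; rewrite inE => /orP[/eqP ->|xxs].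
  by apply/sub_foldl_adjoin/mem_adjoin.
exact: IH (adjoin_ideal _ idJ) xxs.
Qed.

Lemma regular_mod_nth J xs i : regular_mod J xs -> (i < size xs)%N ->
  nonzerodivisor_mod (foldl adjoin J (take i xs)) xs`_i.
Proof.
elim: xs J i => //= x xs IH J [|i] [xreg xsreg] ltis //=.
exact: IH.
Qed.

Lemma regular_modP J xs :
  (forall i, (i < size xs)%N ->
     nonzerodivisor_mod (foldl adjoin J (take i xs)) xs`_i) ->
  regular_mod J xs.
Proof.
elim: xs J => //= x xs IH J reg; split; first exact: (reg 0%N).
by apply: IH => i ltis; apply: (reg i.+1).
Qed.

Lemma regular_mod_rcons J xs x : regular_mod J (rcons xs x) ->
  regular_mod J xs /\ nonzerodivisor_mod (foldl adjoin J xs) x.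
Proof.
elim: xs J => [|y xs IH] J /=; first by case.
by move=> [yreg /IH[ysreg xreg]]; split=> //; split.
Qed.

Lemma nonzerodivisor_mod_exp J x n :
  nonzerodivisor_mod J x -> nonzerodivisor_mod J (x ^+ n).
Proof.
move=> xreg; elim: n => [|n IH] a; first by rewrite mul1r.
by rewrite exprSr -mulrA => /IH; apply: xreg.
Qed.

(** If [x * a = b * y] modulo [J], regularity of [y] modulo [x] gives [b = c * x], and cancelling
    [x] leaves [a = c * y]. This half of permuting [x, y] holds in every ring. *)
Lemma nonzerodivisor_mod_swap J x y : ideal J ->
    nonzerodivisor_mod J x -> nonzerodivisor_mod (adjoin J x) y ->
  nonzerodivisor_mod (adjoin J y) x.
Proof.
move=> idJ xreg yreg a [b Jab].
have [|c Jbc] := yreg b.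
  exists a; have := idealM (-1) idJ Jab; congr (J _); ring.
exists c; apply: xreg.
by have := idealD idJ Jab (idealM y idJ Jbc); congr (J _); ring.
Qed.

Lemma regular_mod_swap J x y xs : ideal J ->
  regular_mod J (x :: y :: xs) -> regular_mod (adjoin J y) (x :: xs).
Proof.
move=> idJ [xreg [yreg xsreg]]; split; last by rewrite adjoinC.
exact: nonzerodivisor_mod_swap.
Qed.

Lemma regular_mod_head_last J x xs : ideal J ->
  regular_mod J (x :: xs) -> nonzerodivisor_mod (foldl adjoin J xs) x.
Proof.
elim: xs J => [|y xs IH] J idJ; first by case.
by move=> /(regular_mod_swap idJ)/IH; apply; apply: adjoin_ideal.
Qed.

(** From [y * a = b * x ^+ n.+1] modulo [J] follows [a = c * x]; cancelling [x] leaves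
    [y * c = b * x ^+ n], ready for induction. *)
Lemma nonzerodivisor_mod_adjoin_exp J x y n : ideal J ->
    nonzerodivisor_mod J x -> nonzerodivisor_mod (adjoin J x) y ->
  nonzerodivisor_mod (adjoin J (x ^+ n)) y.
Proof.
move=> idJ xreg yreg; elim: n => [|n IH] a.
  by move=> _; exists a; rewrite mulr1 subrr; case: idJ.
move=> [b Jab].
have [|c Jac] := yreg a.
  by exists (b * x ^+ n); move: Jab; congr (J _); rewrite exprSr; ring.
have [|e Jce] := IH c.
  exists b; apply: xreg.
  have := idealB idJ Jab (idealM y idJ Jac).
  by congr (J _); rewrite exprSr; ring.
exists e.
have := idealD idJ Jac (idealM x idJ Jce).
by congr (J _); rewrite exprSr; ring.
Qed.

(** Moving [x] past the next element [y] allows induction over [J + (y)] for the tail. *)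
Lemma regular_mod_head_exp J x xs n : ideal J ->
  regular_mod J (x :: xs) -> regular_mod J (x ^+ n :: xs).
Proof.
elim: xs J => [|y xs IH] J idJ reg.
  by split=> //; apply: nonzerodivisor_mod_exp; case: reg.
have [_] := IH _ (adjoin_ideal y idJ) (regular_mod_swap idJ reg).
rewrite adjoinC => xsreg; case: reg => xreg [yreg _].
split; first exact: nonzerodivisor_mod_exp.
by split=> //; apply: nonzerodivisor_mod_adjoin_exp.
Qed.

Lemma regular_mod_exp J xs n : ideal J ->
  regular_mod J xs -> regular_mod J [seq x ^+ n | x <- xs].
Proof.
elim: xs J => //= x xs IH J idJ /(regular_mod_head_exp n idJ) [xreg xsreg].
by split=> //; apply: IH => //; apply: adjoin_ideal.
Qed.

(** The induction hypothesis, taken over [J + (x ^+ n.+1)], removes the other factors; then [x ^+ n]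
    cancels because [x] is regular modulo [J] and the remaining elements. *)
Lemma regular_mod_colon J xs n a : ideal J -> regular_mod J xs ->
  foldl adjoin J [seq x ^+ n.+1 | x <- xs] (a * \prod_(x <- xs) x ^+ n) ->
  foldl adjoin J xs a.
Proof.
elim: xs J a => [|x xs IH] J a idJ reg /=; first by rewrite big_nil mulr1.
rewrite big_cons mulrA => /IH -/(_ (adjoin_ideal _ idJ)) /=.
have [_ xsreg] := regular_mod_head_exp n.+1 idJ reg.
move=> /(_ xsreg); rewrite foldl_adjoinC => -[b Jab].
rewrite foldl_adjoinC; exists b.
apply: (nonzerodivisor_mod_exp (n := n) (regular_mod_head_last idJ reg)).
by have -> : x ^+ n * (a - b * x) = a * x ^+ n - b * x ^+ n.+1
  by rewrite exprSr; ring.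
Qed.

End Ideals.

(** * Noetherian local rings *)

Section Noetherian.
Context (R : comNzRingType).
Implicit Types (I J K P Q S : R -> Prop) (a b c x y z : R) (xs zs : seq R).

Lemma ideal_is_ideal J : ideal J -> is_ideal (fun a => `[< J a >]).
Proof.
move=> [J0 JP]; split=> [|a x y]; first exact/asboolP.
by move=> /asboolP Jx /asboolP Jy; apply/asboolP/JP.
Qed.

Lemma ideal_gen_rcons xs x a :
  (a \in ideal_gen (rcons xs x)) <-> exists b, a - b * x \in ideal_gen xs.
Proof.
split=> [/asboolP[c ->]|[b /asboolP[c def_a]]].
  move: c; rewrite size_rcons => c; exists (c ord_max); apply/asboolP.
  exists (fun i => c (widen_ord (leqnSn _) i)).
  rewrite big_ord_recr /= nth_rcons ltnn eqxx addrK.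
  by apply: eq_bigr => i _; rewrite nth_rcons ltn_ord.
apply/asboolP; rewrite size_rcons.
exists (fun i => if unlift ord_max i is Some j then c j else b).
rewrite big_ord_recr /= unlift_none nth_rcons ltnn eqxx.
apply/eqP; rewrite -subr_eq def_a; apply/eqP; apply: eq_bigr => i _.
rewrite nth_rcons ltn_ord.
have -> : widen_ord (leqnSn _) i = lift ord_max i.
  by apply: val_inj; rewrite /= /bump leqNgt ltn_ord.
by rewrite liftK.
Qed.

Lemma ideal_genP xs a :
  (a \in ideal_gen xs) <-> foldl (@adjoin R) (@zero_ideal R) xs a.
Proof.
elim/last_ind: xs a => [|xs x IH] a.
  split=> [/asboolP[c ->]|->]; first by rewrite big_ord0.
  by apply/asboolP; exists (fun=> 0); rewrite big_ord0.
rewrite foldl_rcons; split=> [/ideal_gen_rcons[b /IH]|[b /IH ?]].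
  by exists b.
by apply/ideal_gen_rcons; exists b.
Qed.

Hypothesis noethR : noetherian R.

(** The union of the chain is finitely generated, and its generators already lie in a single
    [J n]. *)
Lemma noetherian_acc (J : nat -> R -> Prop) :
    (forall n, ideal (J n)) -> (forall n a, J n a -> J n.+1 a) ->
  exists n, forall a, J n.+1 a -> J n a.
Proof.
move=> idJ incJ.
have leJ i j a : (i <= j)%N -> J i a -> J j a.
  by move=> /subnK <-; elim: (j - i)%N => [|k IH] // /IH; apply: incJ.
have [|xs defJ] := noethR (@ideal_is_ideal (fun a => exists n, J n a) _).
  split=> [|a x y [i Jx] [j Jy]]; first by exists 0%N; case: (idJ 0%N).
  exists (maxn i j); apply: (idJ _).2.
    by apply: leJ Jx; rewrite leq_maxl.
  by apply: leJ Jy; rewrite leq_maxr.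
have memJ a : (exists n, J n a) <-> foldl (@adjoin R) (@zero_ideal R) xs a.
  rewrite -ideal_genP -defJ; split=> [?|/asboolP //]; exact/asboolP.
have [n Jxs] : exists n, forall x, x \in xs -> J n x.
  have : forall x, x \in xs -> exists n, J n x.
    move=> x xxs; apply/memJ; apply: mem_foldl_adjoin xxs.
    exact: zero_ideal_ideal.
  elim: (xs) => [|x ys IH] Jys; first by exists 0%N.
  have [|i Ji] := IH; first by move=> y yys; apply: Jys; rewrite inE yys orbT.
  have [|j Jj] := Jys x; first by rewrite inE eqxx.
  exists (maxn i j) => y; rewrite inE => /orP[/eqP->|/Ji].
    by apply: leJ Jj; rewrite leq_maxr.
  by apply: leJ; rewrite leq_maxl.
exists n => a Ja.
have : foldl (@adjoin R) (@zero_ideal R) xs a by apply/memJ; exists n.+1.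
elim/last_ind: (xs) Jxs a {Ja} => [|ys y IH] Jys a.
  by move=> ->; case: (idJ n).
rewrite foldl_rcons => -[b /IH Jab].
rewrite -[a](subrK (b * y)); apply: idealD => //.
  by apply: Jab => x xys; apply: Jys; rewrite mem_rcons inE xys orbT.
by apply: idealM => //; apply: Jys; rewrite mem_rcons mem_head.
Qed.

Lemma noetherian_maximal (F : (R -> Prop) -> Prop) J0 :
    (forall J, F J -> ideal J) -> F J0 ->
  exists J, [/\ F J, forall a, J0 a -> J a &
    forall K, F K -> (forall a, J a -> K a) -> forall a, K a -> J a].
Proof.
move=> idF FJ0; apply: contrapT => noJ.
pose T := {J | F J /\ forall a, J0 a -> J a}.
(* Without a maximal member, iterating a choice of strictly larger members gives a chain that never
   stabilises. *)
have /choice[next nextP] (J : T) : exists K : T,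
    (forall a, sval J a -> sval K a) /\ ~ (forall a, sval K a -> sval J a).
  case: J => J [FJ J0J] /=; apply: contrapT => noK; apply: noJ.
  exists J; split=> // K FK JK; apply: contrapT => nKJ; apply: noK.
  have J0K : forall a, J0 a -> K a by move=> a /J0J /JK.
  by exists (exist _ K (conj FK J0K)).
pose J n := iter n next (exist _ J0 (conj FJ0 (fun a => id))).
have [||n Jn] := @noetherian_acc (fun n => sval (J n)).
- by move=> n; apply: idF; case: (svalP (J n)).
- by move=> n; have [] := nextP (J n).
by have [_] := nextP (J n); apply.
Qed.

Definition prime_pred Q := forall a b, Q (a * b) -> Q a \/ Q b.

Lemma exists_prime_avoiding I S : ideal I ->
    S 1 -> (forall a b, S a -> S b -> S (a * b)) -> (forall a, I a -> ~ S a) ->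
  exists Q, [/\ ideal Q, prime_pred Q, forall a, I a -> Q a,
    forall a, Q a -> ~ S a &
    forall K, ideal K -> (forall a, Q a -> K a) -> (forall a, K a -> ~ S a) ->
      forall a, K a -> Q a].
Proof.
move=> idI S1 SM IS.
have [||Q [[idQ QS] IQ maxQ]] :=
  @noetherian_maximal (fun J => ideal J /\ forall a, J a -> ~ S a) I.
- by move=> J [].
- by [].
exists Q; split=> // [a b Qab|K idK QK KS]; last exact: maxQ.
(* By maximality [Q + (x)] meets [S] when [x] is outside [Q]. For [a] and [b] both outside, the
   product of two such elements of [S] would lie in [Q]. *)
have meet x : ~ Q x -> exists s u, S s /\ Q (s - u * x).
  move=> nQx; apply: contrapT => nS; apply: nQx.
  apply: (maxQ (adjoin Q x)); last exact: mem_adjoin.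
    by split=> [|c [u Qcu] Sc]; [apply: adjoin_ideal | apply: nS; exists c, u].
  by move=> c; apply: sub_adjoin.
apply: contrapT => /not_orP[/meet[s [u [Ss Qs]]] /meet[t [v [St Qt]]]].
apply: QS (SM _ _ Ss St).
have := idealD idQ (idealM (u * v) idQ Qab)
  (idealD idQ (idealM t idQ Qs) (idealM (u * a) idQ Qt)).
by congr (Q _); ring.
Qed.

Lemma prime_idealr_of Q : ideal Q -> ~ Q 1 -> prime_pred Q ->
  exists p : prime_idealr R, forall a, a \in p <-> Q a.
Proof.
move=> idQ Q1 prQ; pose q : R -> bool := fun a => `[< Q a >].
have qP a : reflect (Q a) (a \in q) by apply: asboolP.
have q_id : idealr_closed q.
  split; first exact/qP/idQ.1.
    by apply/negP => /qP.
  by move=> a x y /qP Qx /qP Qy; apply/qP/idQ.2.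
have q_pr : prime_idealr_closed q.
  by move=> a b /qP/prQ[] ?; apply/orP; [left|right]; apply/qP.
pose q_pack : prime_idealr R := HB.pack q (isIdealr.Build R q q_id)
  (isPrimeIdealrClosed.Build R q q_pr).
by exists q_pack => a; split=> /qP.
Qed.


Lemma exists_prime_below J x (P : prime_idealr R) : ideal J ->
    nonzerodivisor_mod J x -> (forall a, adjoin J x a -> a \in P) ->
  exists Q : prime_idealr R, [/\ forall a, J a -> a \in Q,
    {subset Q <= P} & ~ {subset P <= Q}].
Proof.
move=> idJ xreg JP.
have xP : x \in P by apply/JP/mem_adjoin.
(* As [x] is regular modulo [J], the products [x ^+ n * s] with [s] outside [P]
   avoid [J]; a prime over [J] avoiding them lies in [P] and misses [x]. *)
pose S c := exists n s, s \notin P /\ c = x ^+ n * s.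
have S1 : S 1 by exists 0%N, 1; rewrite idealr1 mulr1.
have [||Q [idQ prQ JQ QS _]] := exists_prime_avoiding idJ S1.
- move=> _ _ [i [s [sP ->]]] [j [t [tP ->]]]; exists (i + j)%N, (s * t).
  rewrite prime_idealrM negb_or sP tP; split=> //; rewrite exprD; ring.
- move=> a Ja [n [s [sP def_a]]]; case/negP: sP; apply/JP/sub_adjoin.
  by apply: (nonzerodivisor_mod_exp (n := n) xreg); rewrite -def_a.
have [|q qP] := prime_idealr_of idQ _ prQ; first by move=> /QS.
exists q; split=> [a /JQ /qP //|a /qP Qa|Pq].
  by apply: contrapT => /negP aP; apply: (QS _ Qa); exists 0%N, a;
    rewrite mul1r.
move/qP: (Pq _ xP) => /QS; apply; exists 1%N, 1; split; last by rewrite mulr1.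
by rewrite idealr1.
Qed.

(** The chain is built downwards from [P]: dropping the last element of the sequence allows a step
    to a strictly smaller prime. *)
Lemma prime_chain_regular_mod J xs (P : prime_idealr R) : ideal J ->
    regular_mod J xs -> (forall a, foldl (@adjoin R) J xs a -> a \in P) ->
  exists p : nat -> prime_idealr R, prime_chain (size xs) p /\ p (size xs) = P.
Proof.
move=> idJ; elim/last_ind: xs P => [|xs x IH] P; first by exists (fun=> P).
move=> /regular_mod_rcons[xsreg xreg]; rewrite foldl_rcons size_rcons => JP.
have [Q [JQ QP PQ]] := exists_prime_below (foldl_adjoin_ideal _ idJ) xreg JP.
have [p [pch pQ]] := IH Q xsreg JQ.
exists (fun i => if (i <= size xs)%N then p i else P); rewrite ltnn; split=> //.
move=> i; rewrite ltnS => lei; rewrite lei.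
by case: ltngtP lei => // [/pch //|-> _]; rewrite pQ.
Qed.

(** * The maximal ideal, its powers and systems of parameters *)

Section Local.
Variable m : {pred R}.
Hypothesis locR : is_local_ring m.

Lemma maximal_ideal_ideal : ideal (fun a => a \in m).
Proof. by case: locR => [[[m0 _ mP] _] _]; split. Qed.

Lemma maximal_ideal1 : 1 \notin m.
Proof. by case: locR => [[[]]]. Qed.

Lemma proper_sub_maximal J : ideal J -> ~ J 1 -> forall a, J a -> a \in m.
Proof.
move=> idJ J1 a Ja.
(* With [S = {1}], avoiding [S] means being proper, so [Q] is a maximal ideal over [J]. *)
have [|||Q [idQ prQ JQ Q1 maxQ]] := @exists_prime_avoiding J (eq 1) idJ.
- by [].
- by move=> _ _ <- <-; rewrite mulr1.
- by move=> b Jb b1; rewrite -b1 in Jb.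
have [|q qP] := prime_idealr_of idQ _ prQ; first by move=> /Q1.
suff /locR.2 <- : maximal_ideal q by apply/qP/JQ.
split=> [|K [K0 K1 KP] qK b].
  split; [exact: idealr0 | by rewrite idealr1 | move=> c x y].
  by move=> /qP Qx /qP Qy; apply/qP/idQ.2.
apply/idP/idP => [Kb|/qK //]; apply/qP.
apply: (maxQ (fun b => b \in K)) => // [c /qP /qK //|c Kc c1].
by rewrite -c1 (negPf K1) in Kc.
Qed.

Lemma maximal_ideal_prime :
  exists p : prime_idealr R, forall a, (a \in p) = (a \in m).
Proof.
have [|||Q [idQ prQ mQ Q1 _]] :=
  @exists_prime_avoiding _ (eq 1) maximal_ideal_ideal.
- by [].
- by move=> _ _ <- <-; rewrite mulr1.
- by move=> b + b1; rewrite -b1 (negPf maximal_ideal1).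
have [|q qP] := prime_idealr_of idQ _ prQ; first by move=> /Q1.
exists q => a; apply/idP/idP => [/qP|/mQ/qP //].
by apply: proper_sub_maximal => // /Q1.
Qed.

Lemma one_sub_maximal_inv c x : x \in m -> exists v, v * (1 - c * x) = 1.
Proof.
move=> xm; apply: contrapT => nv.
have idJ := adjoin_ideal (1 - c * x) (zero_ideal_ideal R).
have um : 1 - c * x \in m.
  apply: (proper_sub_maximal idJ); last exact/mem_adjoin/zero_ideal_ideal.
  by move=> [v /eqP]; rewrite subr_eq0 => /eqP ?; apply: nv; exists v.
have := maximal_ideal1; rewrite -(subrK (c * x) 1) => /negP; apply.
exact: idealD maximal_ideal_ideal um (idealM c maximal_ideal_ideal xm).
Qed.

(** A case of Krull's intersection theorem. If [r = b_n * x ^+ n.+1] modulo [J] for all [n], then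
    [b_n = b_(n+1) * x], so the ideals [J + (b_n)] ascend. Once they stop, some unit [1 - c * x]
    multiplies [b_(n+1)] into [J]. *)
Lemma regular_power_avoiding J x r : ideal J -> x \in m ->
    nonzerodivisor_mod J x -> ~ J r -> exists n, ~ adjoin J (x ^+ n.+1) r.
Proof.
move=> idJ xm xreg nJr; apply: contrapT => nn; apply: nJr.
have /choice[b Jb] n : exists b, J (r - b * x ^+ n.+1).
  by apply: contrapT => nb; apply: nn; exists n.
have Jbb n : J (b n - b n.+1 * x).
  apply: (nonzerodivisor_mod_exp (n := n.+1) xreg).
  by have := idealB idJ (Jb n.+1) (Jb n); congr (J _); rewrite !exprSr; ring.
have [||n] := noetherian_acc (J := fun n => adjoin J (b n)).
- by move=> n; apply: adjoin_ideal.
- move=> n a [c Jac]; exists (c * x).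
  by have := idealD idJ Jac (idealM c idJ (Jbb n)); congr (J _); ring.
move=> /(_ _ (mem_adjoin _ idJ))[c Jc].
have [v uv] := one_sub_maximal_inv c xm.
have Jbn : J (b n.+1).
  have := idealM v idJ (idealD idJ Jc (idealM c idJ (Jbb n))).
  congr (J _); rewrite -[RHS]mul1r -uv; ring.
have := idealD idJ (Jb n.+1) (idealM (x ^+ n.+2) idJ Jbn).
by congr (J _); ring.
Qed.

Lemma regular_mod_avoiding J xs r : ideal J -> {subset xs <= m} ->
    regular_mod J xs -> ~ J r ->
  exists zs, [/\ {subset zs <= m}, size zs = size xs, regular_mod J zs
    & ~ foldl (@adjoin R) J zs r].
Proof.
elim: xs J => [|x xs IH] J idJ xsm reg nJr; first by exists nil.
have xm : x \in m by apply: xsm; rewrite mem_head.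
have [n nJn] := regular_power_avoiding idJ xm reg.1 nJr.
have [xnreg xsreg] := regular_mod_head_exp n.+1 idJ reg.
have [|zs [zsm szs zsreg nr]] := IH _ (adjoin_ideal _ idJ) _ xsreg nJn.
  by move=> y yxs; apply: xsm; rewrite inE yxs orbT.
exists (x ^+ n.+1 :: zs); split=> //=; last by rewrite szs.
move=> y; rewrite inE => /orP[/eqP->|/zsm //].
by rewrite exprSr; apply: idealM (maximal_ideal_ideal) xm.
Qed.

(** A prime over [xs] other than [m] would end a chain of length [d], and adding [m] on top would
    exceed the dimension. *)
Lemma regular_parameters_prime d xs (P : prime_idealr R) : krull_dim_eq R d ->
    regular_mod (@zero_ideal R) xs -> size xs = d ->
    (forall a, foldl (@adjoin R) (@zero_ideal R) xs a -> a \in P) ->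
  P =i m.
Proof.
move=> [_ dimR] reg sxs JP a.
have Pm b : b \in P -> b \in m.
  apply: (@proper_sub_maximal (fun b => b \in P)); last by rewrite idealr1.
  by split=> [|c x y Px Py]; [exact: idealr0 | rewrite rpredD ?idealMr].
apply/idP/idP => [/Pm //|am]; apply: contrapT => /negP aP.
have [p [pch pP]] := prime_chain_regular_mod (zero_ideal_ideal R) reg JP.
have [q qP] := maximal_ideal_prime.
have := dimR (size xs).+1 (fun i => if (i <= size xs)%N then p i else q).
rewrite sxs ltnn; apply: contraPP => _ ch.
have /ch // : prime_chain d.+1 (fun i => if (i <= d)%N then p i else q).
move=> i; rewrite ltnS => lei; rewrite lei.
rewrite sxs in pch pP; case: ltngtP lei => // [/pch //|-> _]; rewrite pP.
split=> [b /Pm|/(_ a)]; first by rewrite qP.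
by rewrite qP am (negPf aP) => /(_ isT).
Qed.

Lemma ideal_expD J k l : ideal J ->
    (forall u v, u \in ideal_exp m k -> v \in ideal_exp m l -> J (u * v)) ->
  forall a, a \in ideal_exp m (k + l) -> J a.
Proof.
elim: k J => [|k IH] J idJ Jkl a; first by rewrite -{2}[a]mul1r; apply: Jkl.
move=> /asboolP[s sm ->]; elim: s sm => [|[u v] s IHs] sm.
  by rewrite big_nil; case: idJ.
rewrite big_cons /=; apply: idealD => //; last first.
  by apply: IHs => p ps; apply: sm; rewrite inE ps orbT.
have [/= um vkl] := sm (u, v) (mem_head _ _).
(* The induction hypothesis is applied to the colon ideal [J : u]. *)
apply: (IH (fun v => J (u * v))) vkl.
  split=> [|b x y Jx Jy]; first by rewrite mulr0; case: idJ.
  by have := idJ.2 b _ _ Jx Jy; congr (J _); ring.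
move=> x y xk yl; rewrite mulrA; apply: Jkl => //.
apply/asboolP; exists [:: (u, x)]; last by rewrite big_seq1.
by move=> p; rewrite inE => /eqP ->.
Qed.

Lemma mem_ideal_exp x n : x \in m -> x ^+ n \in ideal_exp m n.
Proof.
move=> xm; elim: n => // n IH; apply/asboolP; exists [:: (x, x ^+ n)].
  by move=> p; rewrite inE => /eqP ->.
by rewrite big_seq1 exprS.
Qed.

(** An ideal over [I] that is maximal among those containing no power of [m] is prime, hence equal
    to [m], a contradiction. *)
Lemma ideal_exp_sub I : ideal I ->
    (forall P : prime_idealr R, (forall a, I a -> a \in P) -> P =i m) ->
  exists n, forall a, a \in ideal_exp m n -> I a.
Proof.
move=> idI Im; apply: contrapT => nI.
pose F J := ideal J /\ ~ exists n, forall a, a \in ideal_exp m n -> J a.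
have [|J [[idJ nJ] IJ maxJ]] := @noetherian_maximal F I _ (conj idI nI).
  by move=> K [].
have grow x : ~ J x -> exists n, forall a, a \in ideal_exp m n -> adjoin J x a.
  move=> nJx; apply: contrapT => nK; apply: nJx.
  apply: (maxJ (adjoin J x)); last exact: mem_adjoin.
    by split=> //; apply: adjoin_ideal.
  by move=> a; apply: sub_adjoin.
have [||p pP] := prime_idealr_of idJ.
- by move=> J1; apply: nJ; exists 0%N => a _; rewrite -[a]mulr1; apply: idealM.
- move=> a b Jab; apply: contrapT => /not_orP[/grow[k Jk] /grow[l Jl]].
  apply: nJ; exists (k + l)%N; apply: ideal_expD => // u v /Jk[s Js] /Jl[t Jt].
  have := idealD idJ (idealM (s * t) idJ Jab)
    (idealD idJ (idealM v idJ Js) (idealM (s * a) idJ Jt)).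
  by congr (J _); ring.
apply: nJ; exists 1%N => a a1; apply/pP; rewrite Im; last by move=> b /IJ /pP.
(* By definition [ideal_exp m 1] is the product of [m] with the unit ideal, not [m] itself. *)
move: a1; rewrite -[1%N]addn0; apply: (ideal_expD maximal_ideal_ideal).
move=> u v /asboolP[s sm ->] _; rewrite mulrC.
apply: idealM maximal_ideal_ideal _; elim: s sm => [|x s IHs] sm.
  by rewrite big_nil; case: maximal_ideal_ideal.
rewrite big_cons; apply: idealD maximal_ideal_ideal _ _; last first.
  by apply: IHs => p' ps; apply: sm; rewrite inE ps orbT.
rewrite mulrC; apply: idealM maximal_ideal_ideal _.
by case: (sm x (mem_head _ _)).
Qed.

End Local.

End Noetherian.

(** * Quotients, and extension of maps into injective modules *)

Local Open Scope quotient_scope.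

Lemma quotient_pi_linear (R : comNzRingType) (V : lmodType R)
    (S : submodClosed V) :
  linear (\pi_(quotient_module S) : V -> quotient_module S).
Proof.
move=> a x y; rewrite quot_piD; congr (_ + _).
by rewrite -[RHS]/(quot_scale _ _) quot_scaleE.
Qed.

Section QuotientLift.
Context (R : comNzRingType) (V W : lmodType R) (S : submodClosed V).
Context (f : {linear V -> W}) (fS : forall x, x \in S -> f x = 0).

Definition quotient_lift of (forall x, x \in S -> f x = 0) :
  quotient_module S -> W := fun q => f (repr q).

Lemma quotient_liftE x : quotient_lift fS (\pi_(quotient_module S) x) = f x.
Proof.
apply/eqP; rewrite -subr_eq0 -linearB; apply/eqP/fS.
by apply/quot_piE; rewrite reprK.
Qed.

Fact quotient_lift_linear : linear (quotient_lift fS).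
Proof.
move=> a p q; rewrite -[p]reprK -[q]reprK.
by rewrite -quotient_pi_linear !quotient_liftE linearP.
Qed.

HB.instance Definition _ := GRing.isLinear.Build R (quotient_module S) W *:%R
  (quotient_lift fS) quotient_lift_linear.

End QuotientLift.

Section Kernel.
Context (R : comNzRingType) (V W : lmodType R) (f : {linear V -> W}).

Definition kernel : {pred V} := fun x => f x == 0.

Fact kernel_submod : submod_closed kernel.
Proof.
split=> [|a x y]; rewrite !unfold_in ?linear0 // => /eqP x0 /eqP y0.
by rewrite linearP x0 y0 scaler0 addr0.
Qed.

HB.instance Definition _ := GRing.isSubmodClosed.Build R V kernel kernel_submod.

End Kernel.

(** Both maps factor through [A] modulo the kernel of [u], where [u] becomes injective. *)
Lemma injective_module_extend (R : comNzRingType) (E A C : lmodType R)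
    (u : {linear A -> C}) (f : {linear A -> E}) : injective_module E ->
    (forall a, u a = 0 -> f a = 0) ->
  exists g : {linear C -> E}, forall a, g (u a) = f a.
Proof.
move=> injE uf.
have uk x : x \in kernel u -> u x = 0 by move/eqP.
have fk x : x \in kernel u -> f x = 0 by move/eqP/uf.
have [|g gE] := injE _ _ (quotient_lift uk : {linear _ -> _})
  (quotient_lift fk : {linear _ -> _}).
  move=> p q; rewrite -[p]reprK -[q]reprK /= !quotient_liftE => upq.
  by apply/quot_piE/eqP; rewrite linearB upq subrr.
exists g => a; have := gE (\pi_(quotient_module (kernel u)) a).
by rewrite /= !quotient_liftE.
Qed.

Section LinearCombination.
Context (R : comNzRingType) (E : lmodType R) (n : nat) (e : 'I_n -> E).

Definition lin_comb (c : 'rV[R]_n) : E := \sum_(j < n) c 0 j *: e j.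

Fact lin_comb_linear : linear lin_comb.
Proof.
move=> a c c'; rewrite /lin_comb scaler_sumr -big_split; apply: eq_bigr => j _.
by rewrite !mxE scalerDl scalerA.
Qed.

HB.instance Definition _ := GRing.isLinear.Build R 'rV[R]_n E *:%R
  lin_comb lin_comb_linear.

Lemma lin_comb_delta i : lin_comb (delta_mx 0 i) = e i.
Proof.
rewrite /lin_comb (bigD1 i) //= mxE !eqxx scale1r big1 ?addr0 // => j /negPf ji.
by rewrite mxE ji andbF scale0r.
Qed.

End LinearCombination.

(** * Iterated connecting homomorphisms *)

Section Zigzag.
Context (R : comNzRingType) (xs : seq R).
Implicit Types (n : nat) (a r : R).

Local Notation J n := (foldl (@adjoin R) (@zero_ideal R) (take n xs)).

(** These [g] form the module [Hom(R / (x_0, ..., x_(n-1)), E)]. *)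
Definition killed_by (E : lmodType R) n (g : E) :=
  forall j, (j < n)%N -> xs`_j *: g = 0.

Lemma killed_byS (E : lmodType R) n (g : E) :
  killed_by n.+1 g <-> killed_by n g /\ xs`_n *: g = 0.
Proof.
split=> [kg|[kg ng] j]; last first.
  by rewrite ltnS leq_eqVlt => /orP[/eqP ->|/kg].
by split=> [j ltjn|]; apply: kg => //; apply: ltnW.
Qed.

Lemma killed_byP (E : lmodType R) n a (g h : E) :
  killed_by n g -> killed_by n h -> killed_by n (a *: g + h).
Proof.
move=> kg kh j ltjn.
by rewrite scalerDr scalerA mulrC -scalerA kg // kh // scaler0 addr0.
Qed.

Lemma killed_by_map (E F : lmodType R) (f : {linear E -> F}) n (g : E) :
  killed_by n g -> killed_by n (f g).
Proof. by move=> kg j /kg; rewrite -linearZ => ->; rewrite linear0. Qed.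

Hypothesis xsreg : regular_mod (@zero_ideal R) xs.

Lemma foldl_adjoin_takeS n : (n < size xs)%N -> J n.+1 = adjoin (J n) xs`_n.
Proof. by move=> ltn; rewrite (take_nth 0) // foldl_rcons. Qed.

Lemma killed_by_adjoin (E : lmodType R) n a (g : E) : (n <= size xs)%N ->
  killed_by n g -> J n a -> a *: g = 0.
Proof.
elim: n a => [|n IH] a len; first by rewrite take0 => _ ->; rewrite scale0r.
move=> /killed_byS[kg ng]; rewrite foldl_adjoin_takeS // => -[b].
move=> /(IH _ (ltnW len) kg)/eqP; rewrite scalerBl -scalerA ng scaler0 subr0.
by move/eqP.
Qed.

(* In an injective module the regular element acts surjectively on the part
   killed by the preceding ones: extend [xs`_j |-> 0] for [j < n] and
   [xs`_n |-> e] to a linear map on [R] and evaluate it at [1]. *)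
Lemma injective_divisible (E : lmodType R) n (e : E) : injective_module E ->
    (n < size xs)%N -> killed_by n e ->
  exists2 g : E, killed_by n g & xs`_n *: g = e.
Proof.
move=> injE ltn ke.
pose u : {linear 'rV[R]_n.+1 -> R^o} :=
  lin_comb (fun j : 'I_n.+1 => xs`_j : R^o).
pose v (j : 'I_n.+1) := if j == ord_max then e else 0.
pose f : {linear 'rV[R]_n.+1 -> E} := lin_comb v.
have fE c : f c = c 0 ord_max *: e.
  rewrite /f /= /lin_comb big_ord_recr /= /v eqxx big1 ?add0r // => j _.
  by rewrite ifN ?scaler0 // -val_eqE /= neq_ltn ltn_ord.
have [|h hE] := @injective_module_extend _ _ _ _ u f injE.
  (* A relation [sum c_j x_j = 0] puts [x_n c_n], hence by regularity [c_n], in the ideal of the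
     earlier elements, which kills [e]. *)
  move=> c uc0; rewrite fE; apply: killed_by_adjoin (ltnW ltn) ke _.
  have idJ := foldl_adjoin_ideal (take n xs) (zero_ideal_ideal R).
  apply: (regular_mod_nth xsreg ltn).
  move: uc0; rewrite /u /= /lin_comb big_ord_recr /= => /(canRL (addKr _)).
  rewrite addr0 [c 0 _ *: _]mulrC => ->; rewrite -mulN1r; apply: idealM => //.
  apply: (big_ind (J n)) => [|x y|j _]; [by case: idJ | exact: idealD | ].
  apply: idealM => //; apply: mem_foldl_adjoin (zero_ideal_ideal R) _.
  have ltj : (j < size (take n xs))%N by rewrite size_takel ?(ltnW ltn).
  by rewrite -(nth_take 0 (ltn_ord j)) mem_nth.
have hxs (j : 'I_n.+1) : xs`_j *: h 1 = v j.
  have := hE (delta_mx 0 j); rewrite /u /f /= !lin_comb_delta => <-.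
  by rewrite -linearZ /= [_ *: _]mulr1.
exists (h 1) => [j ltjn|]; last by have := hxs ord_max; rewrite /v eqxx.
have := hxs (widen_ord (leqnSn n) (Ordinal ltjn)).
by rewrite /v ifN // -val_eqE /= neq_ltn ltjn.
Qed.

Section Resolution.
Context (M : lmodType R) (E : injective_resolution M).
Local Notation d := (differential E).

(* [zigzag n s c]: the class of [s] in [M / (x_0, ..., x_(n-1)) M] is sent to
   the class of [c] by the [n] connecting homomorphisms that come from the
   sequences [0 -> E_(k+1) -> E_k -> E_k -> 0] of multiplication by [x_k], with
   [E_k] the subcomplex of [E] killed by [x_0, ..., x_(k-1)]. *)
Fixpoint zigzag n (s : M) : E n -> Prop :=
  match n with
  | 0 => fun c => c = augmentation E s
  | k.+1 => fun c => exists g : E k,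
      [/\ killed_by k g, zigzag s (xs`_k *: g) & c = d k g]
  end.

Lemma zigzag_linear n a s t (b c : E n) :
  zigzag s b -> zigzag t c -> zigzag (a *: s + t) (a *: b + c).
Proof.
elim: n s t b c => [|n IH] s t b c /=; first by move=> -> ->; rewrite linearP.
move=> [g [kg gz ->]] [h [kh hz ->]]; exists (a *: g + h).
split; [exact: killed_byP | | by rewrite linearP].
by rewrite scalerDr scalerA mulrC -scalerA; apply: IH.
Qed.

Lemma zigzag_scale n a s (c : E n) : zigzag s c -> zigzag (a *: s) (a *: c).
Proof.
(* Writing [a] as [(a - 1) + 1] lets linearity be used with the same zigzag twice. *)
move=> sc; rewrite -[a](subrK 1) !(scalerDl _ (a - 1) 1) !scale1r.
exact: zigzag_linear.
Qed.

Lemma zigzag_cocycle n s (c : E n) : zigzag s c -> d n c = 0.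
Proof.
case: n c => [|n] c /=; first by move=> ->; apply/resolution_exact0; exists s.
by move=> [g [_ _ ->]]; apply: differential_sq.
Qed.

(** The last element [x_n] kills [d g] because [x_n g] is itself a cocycle. *)
Lemma zigzag_killed n s (c : E n) : zigzag s c -> killed_by n c.
Proof.
case: n c => [|n] c //= [g [kg gz ->]]; apply/killed_byS.
by rewrite -linearZ (zigzag_cocycle gz); split=> //; apply: killed_by_map.
Qed.

Lemma exists_zigzag n s : (n <= size xs)%N -> exists c : E n, zigzag s c.
Proof.
elim: n => [|n IH] len /=; first by exists (augmentation E s).
have [c cz] := IH (ltnW len).
have [g kg gc] := injective_divisible (@resolution_injective _ _ E n) len
  (zigzag_killed cz).
by exists (d n g), g; rewrite gc.
Qed.

(** The subcomplex killed by the first [k] elements computes [Ext] from [R / (x_0, ..., x_(k-1))] to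
    [M], which vanishes above degree [k] for a regular sequence. *)
Lemma killed_exact n k (c : E n.+1) : (k <= n)%N -> (k <= size xs)%N ->
    killed_by k c -> d n.+1 c = 0 ->
  exists2 g : E n, killed_by k g & c = d n g.
Proof.
elim: k n c => [|k IH] n c lekn lek.
  by move=> _ /resolution_exact[g ->]; exists g.
case: n c lekn => // n c lekn /killed_byS[kc xc] /IH.
case/(_ (ltnW lekn) (ltnW lek) kc) => g kg def_c.
(* The cocycle [x_k g] is some [d h], and [h = x_k h'] by divisibility; then [g - d h'] still maps
   to [c] and is killed by [x_k] too. *)
have [||h kh def_xg] := IH n (xs`_k *: g) lekn (ltnW lek).
- by move=> j ltj; rewrite scalerA mulrC -scalerA kg ?scaler0.
- by rewrite linearZ /= -def_c.
have [h' kh' def_h] :=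
  injective_divisible (@resolution_injective _ _ E n) lek kh.
exists (g - d n h'); last by rewrite linearB /= differential_sq subr0.
apply/killed_byS; split.
  rewrite addrC -scaleN1r; apply: killed_byP => //; exact: killed_by_map.
by rewrite scalerBr def_xg -def_h linearZ /= subrr.
Qed.

(** Surjectivity of the iterated connecting homomorphism: exactness gives [c = d g], and induction
    applies to the cocycle [x_n g]. *)
Lemma cocycle_zigzag n (c : E n) : (n <= size xs)%N -> killed_by n c ->
  d n c = 0 -> exists s, zigzag s c.
Proof.
elim: n c => [|n IH] c len; first by move=> _ /resolution_exact0.
move=> /killed_byS[kc xc] c0.
have [g kg def_c] := killed_exact (leqnn n) (ltnW len) kc c0.
have [||s gz] := IH (xs`_n *: g) (ltnW len).
- by move=> j ltj; rewrite scalerA mulrC -scalerA kg ?scaler0.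
- by rewrite linearZ /= -def_c.
by exists s, g.
Qed.

End Resolution.

(** Injectivity of the iterated connecting homomorphism on [R / J n]. The [match] says that [c] is a
    coboundary in the subcomplex killed by the first [n] elements. *)
Lemma zigzag_coboundary (E : injective_resolution R^o) n (r : R) (c : E n) :
    (n <= size xs)%N -> zigzag (r : R^o) c ->
    match n return E n -> Prop with
    | 0 => fun c => c = 0
    | k.+1 => fun c => exists2 g, killed_by k.+1 g & c = differential E k g
    end c ->
  J n r.
Proof.
elim: n r c => [|n IH] r c len /=.
  rewrite take0 /= => -> r0; apply: (@augmentation_inj _ _ E r 0).
  by rewrite r0 linear0.
move=> [g [kg gz ->]] [h /killed_byS[kh xh] dgh].
(* The cocycle [g - h] comes from some [s]. As [x_n] kills [h], both [r] and [x_n s] lead to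
   [x_n g], so their difference leads to zero. *)
have [||s gs] := @cocycle_zigzag _ E n (g - h) (ltnW len).
- by rewrite addrC -scaleN1r; apply: killed_byP.
- by rewrite linearB /= dgh subrr.
rewrite foldl_adjoin_takeS //; exists (s : R).
apply: (IH _ 0 (ltnW len)).
  have := zigzag_linear (- xs`_n) gs gz; rewrite scalerBr !scaleNr xh oppr0.
  rewrite subr0 addNr.
  by congr (zigzag _ _); rewrite addrC [_ *: _]mulrC.
by case: {IH} n {len c g kg gz h kh xh dgh s gs} => // n; exists 0 => [j _|];
  rewrite ?scaler0 ?linear0.
Qed.

End Zigzag.

(** The same elements [g] serve as witnesses: replacing [x] by [x ^+ N.+1] multiplies the source by
    [x ^+ N]. *)
Lemma zigzag_exp (R : comNzRingType) (xs : seq R) (M : lmodType R)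
    (E : injective_resolution M) N n (s : M) (c : E n) : (n <= size xs)%N ->
    zigzag xs s c ->
  zigzag [seq x ^+ N.+1 | x <- xs] ((\prod_(x <- take n xs) x ^+ N) *: s) c.
Proof.
elim: n s c => [|n IH] s c len /=.
  by rewrite take0 big_nil scale1r.
move=> [g [kg gz ->]]; exists g; split=> //.
  move=> j ltj; rewrite (nth_map 0) ?(ltn_trans ltj) // exprSr -scalerA.
  by rewrite kg // scaler0.
have := zigzag_scale (xs`_n ^+ N) (IH _ _ (ltnW len) gz).
rewrite (nth_map 0) // (take_nth 0) // -cats1 big_cat big_seq1 /=.
by rewrite !scalerA exprSr [_ * xs`_n ^+ N]mulrC.
Qed.

(** * Chain maps between resolutions and the induced maps on cohomology *)

Section ChainMap.
Context (R : comNzRingType) (M N : lmodType R) (f : {linear M -> N}).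
Context (E : injective_resolution M) (F : injective_resolution N).

Lemma exists_chain_map : exists phi : forall n, {linear E n -> F n},
  (forall x, phi 0%N (augmentation E x) = augmentation F (f x)) /\
  (forall n x, phi n.+1 (differential E n x) = differential F n (phi n x)).
Proof.
(* The invariant that cocycles go to cocycles makes [differential F n \o phi] vanish on the kernel
   of [differential E n], so that it extends to the next degree. *)
pose T n := {phi : {linear E n -> F n} |
  forall x, differential E n x = 0 -> differential F n (phi x) = 0}.
have step n (p : T n) : exists q : T n.+1, forall x,
    sval q (differential E n x) = differential F n (sval p x).
  case: p => phi phi0.
  have [//|psi psiE] := @injective_module_extend _ _ _ _ (differential E n)
    (differential F n \o phi : {linear E n -> F n.+1})
    (@resolution_injective _ _ F n.+1).
  have psi0 x : differential E n.+1 x = 0 -> differential F n.+1 (psi x) = 0.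
    by move=> /resolution_exact[y ->]; rewrite psiE /= differential_sq.
  by exists (exist _ psi psi0).
have [|phi0 phi0E] := @injective_module_extend _ _ _ _ (augmentation E)
  (augmentation F \o f : {linear M -> F 0%N}) (@resolution_injective _ _ F 0%N).
  move=> x x0; rewrite /= (@augmentation_inj _ _ E x 0) ?linear0 //.
have phi00 x : differential E 0 x = 0 -> differential F 0 (phi0 x) = 0.
  move=> /resolution_exact0[y ->]; rewrite phi0E /=.
  by apply/resolution_exact0; exists (f y).
pose phi := nat_rect T (exist _ phi0 phi00)
  (fun n p => sval (cid (step n p))).
exists (fun n => sval (phi n)); split=> [x|n x]; first exact: phi0E.
by rewrite /= (svalP (cid (step n (phi n)))).
Qed.

Lemma zigzag_map (phi : forall n, {linear E n -> F n}) xs n s (c : E n) :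
    (forall x, phi 0%N (augmentation E x) = augmentation F (f x)) ->
    (forall n x, phi n.+1 (differential E n x) = differential F n (phi n x)) ->
  zigzag xs s c -> zigzag xs (f s) (phi n c).
Proof.
move=> phi0 phid; elim: n s c => [|n IH] s c /=; first by move=> ->.
move=> [g [kg gz ->]]; exists (phi n g).
split; [exact: killed_by_map | | exact: phid].
by rewrite -linearZ; apply: IH.
Qed.

End ChainMap.

Section CohomologyMap.
Context (R : comNzRingType) (C D : cochain_complex R).
Context (phi : forall n, {linear C n -> D n}).
Context (phid : forall n x,
  phi n.+1 (differential C n x) = differential D n (phi n x)).
Context (n : nat).

Fact cocycle_map_subproof (z : submodule (@cocycles R C n)) :
  phi n (\val z) \in @cocycles R D n.
Proof.
by case: z => z /= /eqP z0; apply/eqP; rewrite -phid z0 linear0.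
Qed.

Definition cocycle_map z : submodule (@cocycles R D n) :=
  Submodule (cocycle_map_subproof z).

Definition cocycle_class z : cohomology D n :=
  \pi_(quotient_module (@coboundaries R D n)) (cocycle_map z).

Fact cocycle_class_linear : linear cocycle_class.
Proof.
move=> a x y; rewrite /cocycle_class -quotient_pi_linear; congr (\pi _).
by apply: val_inj; rewrite /= linearP.
Qed.

HB.instance Definition _ := GRing.isLinear.Build R (submodule (@cocycles R C n))
  (cohomology D n) *:%R cocycle_class cocycle_class_linear.

Lemma cocycle_class_eq0 z :
  cocycle_class z = 0 <-> is_coboundary (phi n (\val z)).
Proof.
rewrite -(linear0 cocycle_class) quot_piE.
by split=> [/asboolP|?]; [|apply/asboolP]; rewrite /= linear0 subr0.
Qed.

Lemma cocycle_class_coboundary z :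
  z \in @coboundaries R C n -> cocycle_class z = 0.
Proof.
move=> /asboolP zb; apply/cocycle_class_eq0.
case: n z zb => [|k] z /=; first by move=> ->; rewrite linear0.
by move=> [y ->]; exists (phi k y); rewrite phid.
Qed.

Definition cohomology_map : linhom (cohomology C n) (cohomology D n) :=
  quotient_lift cocycle_class_coboundary.

End CohomologyMap.

Lemma cohomology_mapE (R : comNzRingType) (C D : cochain_complex R)
    (phi : forall n, {linear C n -> D n})
    (phid : forall n x,
      phi n.+1 (differential C n x) = differential D n (phi n x)) n z :
  cohomology_map phid n (\pi_(quotient_module (@coboundaries R C n)) z) =
  cocycle_class phid z.
Proof. exact: quotient_liftE. Qed.

(** * A non-zero map on top local cohomology *)

Lemma torsionless_separated (R : comNzRingType) (B : lmodType R) (b : B) :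
  torsionless B -> b != 0 -> exists f : {linear B -> R^o}, f b != 0.
Proof.
move=> tB b0; apply: contrapT => nf; case/eqP: b0; apply: tB.
apply: homP => f /=; rewrite /bidual_fun linear0.
by apply: contrapT => /eqP fb; apply: nf; exists f.
Qed.

Theorem theorem5p6 (R : comNzRingType) (m : {pred R}) (d : nat)
    (hR : cohen_macaulay_local m d)
    (B : lmodType R) (hB : torsionless B) (hB0 : exists b : B, b != 0)
    (EB : injective_resolution B) (ER : injective_resolution R^o) :
  exists f : linhom (local_cohomology m EB d) (local_cohomology m ER d), f != 0.
Proof.
case: hR => noethR locR dimR [[xs [xsm [xsreg _] sxs]] _].
have [b b0] := hB0; have [f fb0] := torsionless_separated hB b0.
have id0 := zero_ideal_ideal R.
have [||zs [zsm szs zsreg nfb]] :=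
  regular_mod_avoiding noethR locR (xs := xs) (r := f b) id0 xsm.
- apply: regular_modP => i lti a /ideal_genP xa.
  by apply/ideal_genP; apply: xsreg.
- exact/eqP.
rewrite {}sxs in szs; have led : (d <= size zs)%N by rewrite szs.
have [|k mk] := @ideal_exp_sub R noethR m locR _ (foldl_adjoin_ideal zs id0).
  by move=> P; apply: (regular_parameters_prime noethR locR dimR).
have [c cz] := exists_zigzag zsreg EB b led.
have tc : c \in torsion m (E := EB d).
  apply/asboolP; exists k => a /mk; rewrite -(take_size zs) szs.
  exact: killed_by_adjoin (zigzag_killed cz).
have zc : (Submodule tc : torsion_complex m EB d) \in
    @cocycles R (torsion_complex m EB) d.
  by apply/eqP/val_inj; rewrite /= (zigzag_cocycle cz).
have [phi [phi0 phid]] := exists_chain_map f EB ER.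
pose tphi n : {linear torsion_complex m EB n -> torsion_complex m ER n} :=
  @torsion_map R m (EB n) (ER n) (phi n).
have tphid n x : tphi n.+1 (differential (torsion_complex m EB) n x) =
    differential (torsion_complex m ER) n (tphi n x).
  by apply: val_inj; rewrite /= phid.
exists (cohomology_map tphid d); apply/eqP => map0.
have := cohomology_mapE tphid (Submodule zc).
rewrite map0 => /esym/cocycle_class_eq0 /= cb.
apply: nfb.
(* A torsion [g] is killed by some power [m^N], hence by every [z ^+ N.+1]; the successor matches
   the exponents in [regular_mod_colon]. In degree 0 a coboundary is zero and [N = 0] serves. *)
have [N cbN] : exists N, match d return ER d -> Prop with
    | 0 => fun c => c = 0
    | k.+1 => fun c => exists2 g,
        killed_by [seq x ^+ N.+1 | x <- zs] k.+1 g & c = differential ER k g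
    end (phi d c).
  case: (d) led c tc {cz zc map0} cb => [|n] led c tc.
    by move=> /(congr1 val) /=; exists 0%N.
  move=> [[g tg] /(congr1 val) /= def_c]; have /asboolP[N gN] := tg.
  exists N, g => // j ltj; have ltz := leq_trans ltj led.
  rewrite (nth_map 0) // exprS -scalerA gN ?scaler0 //.
  by apply/mem_ideal_exp/zsm/mem_nth.
have zsNreg := regular_mod_exp N.+1 id0 zsreg.
(* What remains is that [f b] times the product of the [z ^+ N] lies in the ideal of the
   [z ^+ N.+1]; this multiple of [f b] is the source of the same cocycle for the powers. *)
apply: (regular_mod_colon (n := N) id0 zsreg).
have led' : (d <= size [seq x ^+ N.+1 | x <- zs])%N by rewrite size_map.
have := zigzag_coboundary zsNreg led' (zigzag_map phi0 phid
  (zigzag_exp N led cz)) cbN.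
by rewrite -szs -{1}(size_map (fun x => x ^+ N.+1)) !take_size linearZ mulrC.
Qed.
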